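(* Let $K\subseteq\mathbb{R}^d$ be a Besicovitch set. Then \[ \dim_{\rm LB}(K)\ge \frac{d+1}{2},\qquad \dim_{\rm P}(K)\ge \frac{d+1}{2},\qquad\text{and}\qquad \dim_{\rm P}(K)+\dim_{\rm H}(K)\ge d+1 . \]
   Context: A Besicovitch set in $\mathbb{R}^d$ is a bounded set $K\subseteq\mathbb{R}^d$ that contains a unit line segment in every direction: for every $\theta\in S^{d-1}$ (the unit sphere of $\mathbb{R}^d$) there is $t\in\mathbb{R}^d$ with $\{s\theta+t : s\in[0,1]\}\subseteq K$. No measurability is assumed. For a bounded set $A\subseteq\mathbb{R}^d$ let $N(A,\epsilon)$ be the minimum number of balls of radius $\epsilon$ required to cover $A$. The lower and upper box-counting dimensions are \[ \dim_{\rm LB}(A)=\liminf_{\epsilon\to0}\frac{\log N(A,\epsilon)}{-\log\epsilon},\qquad \dim_{\rm B}(A)=\limsup_{\epsilon\to0}\frac{\log N(A,\epsilon)}{-\log\epsilon}. \] The packing dimension is $\dim_{\rm P}(A)=\inf\{\sup_i\dim_{\rm B}(A_i): A=\bigcup_{i=1}^\infty A_i\}$. $\dim_{\rm H}$ is the Hausdorff dimension. *)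

(* Defs.v *)
From HB Require Import structures.
From mathcomp Require Import all_boot all_order all_algebra.
From mathcomp Require Import all_classical all_reals all_analysis.
Set Implicit Arguments.
Unset Strict Implicit.
Unset Printing Implicit Defensive.
Import Order.TTheory GRing.Theory Num.Theory.
Import numFieldNormedType.Exports.
Local Open Scope classical_set_scope.
Local Open Scope ring_scope.

Section Dimensions.
Variables (R : realType) (d : nat).
Implicit Types (A K U : set 'rV[R]_d) (x t : 'rV[R]_d) (e s : R).

(* The norm provided by the library on 'rV[R]_d is the sup norm, so the
   Euclidean norm (hence the unit sphere, balls and diameters) is defined
   here. *)
Definition enorm x : R := Num.sqrt (\sum_(i < d) x 0 i ^+ 2).

Definition esphere : set 'rV[R]_d := [set x | enorm x = 1].

Definition eball x e : set 'rV[R]_d := [set y | enorm (y - x) <= e].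

(* [bounded_set] refers to the sup norm; in finite dimension this is the same
   as boundedness for the Euclidean norm. *)
Definition besicovitch K : Prop :=
  bounded_set K /\
  forall theta, esphere theta ->
    exists t, [set s *: theta + t | s in `[0, 1]] `<=` K.

(* The value is +oo when no finite cover exists; this does not happen for
   bounded sets when 0 < e. *)
Definition covering_number A e : \bar R :=
  ereal_inf [set n%:R%:E | n in [set n : nat |
    exists c : 'I_n -> 'rV[R]_d, A `<=` \bigcup_i eball (c i) e]].

(* Since lne 0 = -oo, the empty set has box dimensions -oo. *)
Definition box_ratio A e : \bar R :=
  (lne (covering_number A e) / (- ln e)%:E)%E.

Definition lower_box_dim A : \bar R := limf_einf (box_ratio A) 0^'+.

Definition upper_box_dim A : \bar R := limf_esup (box_ratio A) 0^'+.

(* For bounded A, the pieces of a decomposition of A are bounded too. *)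
Definition packing_dim A : \bar R :=
  ereal_inf [set ereal_sup (range (fun i => upper_box_dim (F i))) |
    F in [set F : nat -> set 'rV[R]_d | A = \bigcup_i F i]].

Definition diam U : \bar R :=
  ereal_sup [set (enorm (x - y))%:E | x in U & y in U].

(* diam U ^ s, with the conventions 0 ^ 0 = 1 for nonempty U (as given by
   poweR), and 0 for the empty set whatever the exponent. *)
Definition diam_pow s U : \bar R :=
  if U == set0 then 0%E else (diam U `^ s)%E.

Definition hausdorff_premeasure s e A : \bar R :=
  ereal_inf [set (\sum_(0 <= i <oo) diam_pow s (F i))%E |
    F in [set F : nat -> set 'rV[R]_d |
      A `<=` \bigcup_i F i /\ forall i, (diam (F i) <= e%:E)%E]].

Definition hausdorff_measure s A : \bar R :=
  ereal_sup [set hausdorff_premeasure s e A | e in [set e : R | 0 < e]].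

Definition hausdorff_dim A : \bar R :=
  ereal_inf [set s%:E | s in [set s : R |
    0 <= s /\ hausdorff_measure s A = 0%E]].

End Dimensions.

(* Main.v *)
Require Import Defs.
From mathcomp Require Import all_boot all_order all_algebra.
From mathcomp Require Import all_classical all_reals all_analysis.
From mathcomp Require Import measurable_realfun ring lra.
Set Implicit Arguments.
Unset Strict Implicit.
Unset Printing Implicit Defensive.
Import Order.TTheory GRing.Theory Num.Theory.
Local Open Scope classical_set_scope.
Local Open Scope ring_scope.

(** A segment of direction theta contributes to K - K the whole segment of
    multiples of theta, and each multiple r theta, |r| < 1, arises from a
    one-parameter family of pairs of points.  Thus the pairs of points of K lying
    on a common prescribed segment carry d - 1 parameters for the direction and
    two for the positions on the segment, and K x K should have dimension at
    least d + 1.  The three inequalities are quantitative forms of this remark.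

    Directions are parametrised by slopes v in R^(d-1), the direction being that
    of (1, v).  Suppose that a set A meets, for many slopes v, some line of
    slope v in a set of outer length at least delta.  Cover A by balls
    B(y_j, r_j), and for each j cover A again by m_j balls B(x_jk, r_j) of that
    same radius.  If a line of slope v meets B(x_jk, r_j) and B(y_j, r_j) at
    parameters at least delta / 4 apart, then v is known up to O(r_j / delta)
    ([slope_separation]), so a pair (j, k) serves only a set of slopes of measure
    O(r_j^(d-1)).  On the other hand, for a single slope the pairs met in this
    way satisfy sum r_j^2 >= delta^2 / 8: the radii r_j of the balls touching the
    line add up to at least delta / 2 ([touching_radii]), and for each of them the
    number of balls B(x_jk, r_j) hit far away is at least delta / (4 r_j)
    ([far_hits]).  Integrating over the slopes gives
      c <= sum_j m_j r_j^(d+1)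
    with c > 0 depending on A only ([two_scale_sum_lower_bound]).

    Let K be the union of countably many pieces F_i.  Since outer measures are
    countably subadditive, first on each line and then on the space of slopes,
    some piece F_i satisfies the hypothesis made on A ([besicovitch_piece]); no
    measurability of K, or of the choice of the segments, enters.  It remains to
    choose the covers.
    - Covers by N balls of one radius rho give N^2 rho^(d+1) >= c, hence lower box
      dimension at least (d+1)/2; this is applied to K itself, and to a piece of a
      decomposition of K for the packing dimension.
    - If F_i has upper box dimension less than alpha and K has zero s-dimensional
      Hausdorff measure, take for B(y_j, r_j) an efficient Hausdorff cover of K,
      and m_j <= r_j^(-alpha).  The sum is at most sum_j r_j^(d+1-alpha), which
      can be made arbitrarily small when alpha + s < d + 1; so alpha + s >= d + 1
      ([upper_box_hausdorff]). *)

(** * Outer length on the line *)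

Section OuterLength.
Variable R : realType.

(** The intersection of an arbitrary set with a line need not be measurable;
    hence an outer measure, countably subadditive on all sets. *)
Definition outer_length (S : set R) : \bar R := (@wlength R idfun)^*%mu S.

Lemma outer_length_ge0 (S : set R) : (0 <= outer_length S)%E.
Proof. exact: (outer_measure_ge0 (@wlength R idfun)^*%mu). Qed.

Lemma outer_length0 : outer_length set0 = 0%E.
Proof. exact: (outer_measure0 (@wlength R idfun)^*%mu). Qed.

Lemma le_outer_length (A B : set R) :
  A `<=` B -> (outer_length A <= outer_length B)%E.
Proof. exact: (le_outer_measure (@wlength R idfun)^*%mu). Qed.

Lemma outer_length_bigcup (F : nat -> set R) :
  (outer_length (\bigcup_i F i) <= \sum_(0 <= i <oo) outer_length (F i))%E.
Proof. exact: (outer_measure_sigma_subadditive (@wlength R idfun)^*%mu). Qed.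

Lemma outer_lengthU (A B : set R) :
  (outer_length (A `|` B) <= outer_length A + outer_length B)%E.
Proof. exact: (outer_measureU2 (@wlength R idfun)^*%mu). Qed.

Lemma outer_length_bigsetU (F : nat -> set R) m :
  (outer_length (\big[setU/set0]_(i < m) F i) <= \sum_(i < m) outer_length (F i))%E.
Proof. exact: (outer_measure_subadditive (@wlength R idfun)^*%mu). Qed.

Lemma outer_length_itv (a b : R) : a <= b -> outer_length `[a, b] = (b - a)%:E.
Proof.
move=> ab; rewrite -[LHS]/(lebesgue_measure _) lebesgue_measure_itv /= lte_fin.
by have [lt|ge] := ltP a b; rewrite -?EFinB//; congr (_%:E); lra.
Qed.

End OuterLength.
Arguments outer_length {R}.

(** * Lines of given slope *)

Section Slopes.
Variables (R : realType) (n : nat).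
Implicit Types (r delta : R) (A : set 'rV[R]_n.+1) (t x y : 'rV[R]_n.+1) (v : 'rV[R]_n).

(** Normalising the first coordinate to 1, rather than the length, makes the
    parameter on a line of given slope a coordinate of the point, and gives the
    directions a flat parameter space. *)
Definition slope_vector v : 'rV[R]_n.+1 := \row_i oapp (v 0) 1 (unlift ord0 i).

Lemma slope_vector0 v : slope_vector v 0 ord0 = 1.
Proof. by rewrite mxE unlift_none. Qed.

Lemma ler_enorm m (x : 'rV[R]_m) i : `|x 0 i| <= enorm x.
Proof.
rewrite -sqrtr_sqr; apply: ler_wsqrtr.
by rewrite (bigD1 i)//= lerDl sumr_ge0// => j _; exact: sqr_ge0.
Qed.

Lemma eball_coord m (x y : 'rV[R]_m) r i : eball x r y -> `|y 0 i - x 0 i| <= r.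
Proof. by move=> h; apply: le_trans h; have := ler_enorm (y - x) i; rewrite !mxE. Qed.

(** The differences of the two points on either line agree up to 4 r in every
    coordinate.  The first coordinate compares s - u with s' - u', the others
    compare (s - u) v with (s' - u') v'; dividing by s - u, which is at least eta,
    gives the slopes. *)
Lemma slope_separation v v' t t' x y (s u s' u' r eta : R) :
  0 < eta -> (forall i, `|v' 0 i| <= 1) -> eta <= `|s - u| ->
  eball x r (s *: slope_vector v + t) -> eball y r (u *: slope_vector v + t) ->
  eball x r (s' *: slope_vector v' + t') ->
  eball y r (u' *: slope_vector v' + t') ->
  forall i, `|v 0 i - v' 0 i| <= 8 * r / eta.
Proof.
move=> eta0 v1 su hx hy hx' hy' i.
have E0 : `|(s - u) - (s' - u')| <= 4 * r.
  move: (eball_coord ord0 hx) (eball_coord ord0 hy) (eball_coord ord0 hx')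
    (eball_coord ord0 hy').
  rewrite !mxE unlift_none /= !mulr1 !ler_norml => /andP[? ?] /andP[? ?]
    /andP[? ?] /andP[? ?]; apply/andP; split; lra.
have Ei : `|(s - u) * v 0 i - (s' - u') * v' 0 i| <= 4 * r.
  move: (eball_coord (lift ord0 i) hx) (eball_coord (lift ord0 i) hy)
    (eball_coord (lift ord0 i) hx') (eball_coord (lift ord0 i) hy').
  rewrite !mxE liftK /= !ler_norml => /andP[? ?] /andP[? ?]
    /andP[? ?] /andP[? ?]; apply/andP; split; lra.
have r0 : 0 <= r by exact: le_trans (eball_coord ord0 hx).
rewrite ler_pdivlMr// mulrC (le_trans (ler_wpM2r _ su))//.
rewrite -normrM.
have -> : (s - u) * (v 0 i - v' 0 i) = ((s - u) * v 0 i - (s' - u') * v' 0 i)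
    - ((s - u) - (s' - u')) * v' 0 i by ring.
rewrite (le_trans (ler_normB _ _))// normrM.
have := ler_pM (normr_ge0 _) (normr_ge0 _) E0 (v1 i).
lra.
Qed.

Lemma chord_eball_sub v t x r :
  [set s | eball x r (s *: slope_vector v + t)] `<=`
  `[x 0 ord0 - t 0 ord0 - r, x 0 ord0 - t 0 ord0 + r].
Proof.
move=> s /(eball_coord ord0); rewrite !mxE unlift_none /= mulr1 in_itv /=.
by rewrite !ler_norml => /andP[? ?]; apply/andP; split; lra.
Qed.

Definition chord A v t : set R := [set s | A (s *: slope_vector v + t)].

Definition rich A delta v :=
  exists t, (delta%:E <= outer_length (chord A v t))%E.

Lemma outer_length_chord_eball v t x r : 0 <= r ->
  (outer_length (chord (eball x r) v t) <= (2 * r)%:E)%E.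
Proof.
move=> r0.
apply: (le_trans (le_outer_length (@chord_eball_sub v t x r))).
by rewrite outer_length_itv ?lee_fin; lra.
Qed.

End Slopes.

(** * The measure on slopes *)

Section SlopeSpace.
Variable R : realType.

(** R^n with its Lebesgue measure is needed only through the measure of cubes, so
    an iterated product with a coordinate map c suffices. *)
Lemma slope_space n : exists (disp : measure_display)
    (T : measurableType disp) (mu : {measure set T -> \bar R})
    (c : T -> 'rV[R]_n), forall (a : 'rV[R]_n) (l : R), 0 <= l ->
  measurable [set p | forall i, `|c p 0 i - a 0 i| <= l] /\
  mu [set p | forall i, `|c p 0 i - a 0 i| <= l] = ((2 * l) ^+ n)%:E.
Proof.
elim: n => [|n [disp [T [mu [c IH]]]]].
  exists _, unit, (@dirac _ unit tt R), (fun _ => 0) => a l l0.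
  rewrite (_ : [set _ | _] = setT); last by apply/seteqP; split=> // x _ [].
  by split; [exact: measurableT|rewrite expr0 /= diracT].
exists _, (T * measurableTypeR R)%type,
  (mu \x (@lebesgue_measure R))%E,
  (fun p => \row_i oapp (c p.1 0) p.2 (unlift ord0 i)) => a l l0.
have [mB muB] := IH (\row_i a 0 (lift ord0 i)) l l0.
set B := [set p | _] in mB muB.
pose I : set R := [set` `[a 0 ord0 - l, a 0 ord0 + l]].
have -> : [set p : T * measurableTypeR R | forall i,
    `|(\row_i oapp (c p.1 0) p.2 (unlift ord0 i)) 0 i - a 0 i| <= l] = B `*` I.
  apply/seteqP; split=> -[p s] /=.
    move=> h; split=> [i|] /=.
      by have := h (lift ord0 i); rewrite !mxE liftK.
    have := h ord0; rewrite !mxE unlift_none /= /I /= in_itv /=.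
    by rewrite ler_norml => /andP[? ?]; apply/andP; split; lra.
  move=> [/= hB]; rewrite /I /= in_itv /= => /andP[h1 h2] i.
  rewrite !mxE; case: unliftP => [j ->|->] /=.
    by have := hB j; rewrite !mxE.
  by rewrite ler_norml; apply/andP; split; lra.
have mI : measurable (I : set (measurableTypeR R)) by exact: measurable_itv.
split; first exact: measurableX.
apply: etrans (product_measure1E mu (@lebesgue_measure R) mB mI) _.
rewrite muB exprSr EFinM; congr (_ * _)%E.
rewrite -[LHS]/(outer_length I) outer_length_itv; last by lra.
by congr (_%:E); ring.
Qed.

End SlopeSpace.

(** * Counting the balls met by one line *)

Section Counting.
Variables (R : realType) (n : nat).
Implicit Types (A : set 'rV[R]_n.+1) (t : 'rV[R]_n.+1) (v : 'rV[R]_n).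

(** The part of the chord at distance at most delta / 4 from u has length at most
    delta / 2, so the balls hit elsewhere cover outer length at least delta / 2,
    each of them at most 2 r.  The point u will be a parameter at which the line
    meets some other ball. *)
Lemma far_hits A v t (delta r u : R) (m : nat) (x : nat -> 'rV[R]_n.+1) :
  0 < r -> (delta%:E <= outer_length (chord A v t))%E ->
  A `<=` \bigcup_(k in `I_m) eball (x k) r ->
  delta / 4 <= \sum_(k < m) r * (`[< exists2 s, delta / 4 <= `|s - u| &
    eball (x k) r (s *: slope_vector v + t) >])%:R.
Proof.
move=> r0 rA cov.
pose hit k := `[< exists2 s, delta / 4 <= `|s - u| &
  eball (x k) r (s *: slope_vector v + t) >].
have [delta0|delta0] := ltP 0 delta; last first.
  apply: (@le_trans _ _ 0); first by lra.
  by apply: sumr_ge0 => k _; rewrite mulr_ge0// ltW.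
pose I : set R := `[u - delta / 4, u + delta / 4]%classic.
pose F k : set R := if hit k then chord (eball (x k) r) v t else set0.
have sub : chord A v t `<=` I `|` \big[setU/set0]_(k < m) F k.
  move=> s sA; have [near|far] := leP `|s - u| (delta / 4).
    left; rewrite /I /= in_itv /=; move: near; rewrite ler_norml => /andP[? ?].
    by apply/andP; split; lra.
  right; have [k /= km xk] := cov _ sA.
  rewrite -bigcup_mkord; exists k => //.
  rewrite /F (_ : hit k) //; apply/asboolP; exists s => //; exact: ltW.
have : (delta%:E <= (delta / 4 + delta / 4)%:E + (\sum_(k < m) (2 * r) * (hit k)%:R)%:E)%E.
  apply: (le_trans rA); apply: (le_trans (le_outer_length sub)).
  apply: (le_trans (outer_lengthU _ _)); apply: leeD.
    by rewrite outer_length_itv ?lee_fin; lra.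
  apply: (le_trans (outer_length_bigsetU _ _)); rewrite -sumEFin.
  apply: lee_sum => k _; rewrite /F; case: (hit k).
    by rewrite mulr1; apply: outer_length_chord_eball; exact: ltW.
  by rewrite mulr0 outer_length0.
rewrite -EFinD lee_fin.
under eq_bigr do rewrite -mulrA.
rewrite -mulr_sumr /hit; lra.
Qed.

Lemma touching_radii A v t (delta : R) (P : pred nat) (y : nat -> 'rV[R]_n.+1)
    (r : nat -> R) :
  (forall j, 0 < r j) -> (delta%:E <= outer_length (chord A v t))%E ->
  A `<=` \bigcup_(j in [set j | P j]) eball (y j) (r j) ->
  (delta%:E <= \sum_(0 <= j <oo) (2 * r j * (P j && `[< exists u,
     eball (y j) (r j) (u *: slope_vector v + t) >])%:R)%:E)%E.
Proof.
move=> r0 rA cov.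
pose F j : set R := if P j then chord (eball (y j) (r j)) v t else set0.
have sub : chord A v t `<=` \bigcup_j F j.
  by move=> s /cov[j Pj yj]; exists j => //; rewrite /F ifT.
apply: (le_trans rA); apply: (le_trans (le_outer_length sub)).
apply: (le_trans (outer_length_bigcup _)); apply: lee_nneseries => [j _ _|j _].
  exact: outer_length_ge0.
rewrite /F; case: (P j) => /=; last by rewrite mulr0 outer_length0.
case: asboolP => [_|none].
  by rewrite mulr1; apply: outer_length_chord_eball; exact: ltW.
rewrite mulr0 (_ : chord _ _ _ = set0) ?outer_length0//.
by apply/seteqP; split=> // u yu; apply: none; exists u.
Qed.

End Counting.

(** * The two-scale inequality *)

Section MarkovSeries.
Context d (T : measurableType d) (R : realType).
Variable mu : {measure set T -> \bar R}.
Local Open Scope ereal_scope.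

(** Markov's inequality for a set Theta that need not be measurable: it is
    enclosed in the measurable set where the series is large. *)
Lemma markov_series (h : nat -> T -> \bar R) (Theta : set T) (kappa : R) :
  (forall j p, 0 <= h j p) -> (forall j, measurable_fun setT (h j)) ->
  (0 < kappa)%R ->
  (forall p, Theta p -> kappa%:E <= \sum_(0 <= j <oo) h j p) ->
  exists M, [/\ measurable M, Theta `<=` M &
    kappa%:E * mu M <= \sum_(0 <= j <oo) \int[mu]_p h j p].
Proof.
move=> h0 mh kappa0 hTheta.
pose g p := \sum_(0 <= j <oo) h j p.
have mg : measurable_fun setT g by exact: (@ge0_emeasurable_sum _ _ _ _ h xpredT).
have g0 p : 0 <= g p by apply: nneseries_ge0.
exists [set p | kappa%:E <= g p].
have mM : measurable [set p | kappa%:E <= g p].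
  by rewrite -[X in measurable X]setTI; exact: emeasurable_fun_c_infty.
split=> //; rewrite -integral_nneseries//.
have := @le_integral_comp_abse _ T R mu setT measurableT g kappa id
  (@measurable_id _ _ _) (fun r => id) (fun x y _ _ => id) mg kappa0.
rewrite setTI.
under [X in mu X]eq_set do rewrite gee0_abs//.
by under eq_integral do rewrite gee0_abs//.
Qed.

End MarkovSeries.

Section TwoScale.
Variables (R : realType) (n : nat).
Implicit Types (A : set 'rV[R]_n.+1).

(** The predicate P selects the indices in use, so that finite covers and covers
    with empty members need no dummy balls. *)
Definition two_scale_cover A (P : pred nat) (y : nat -> 'rV[R]_n.+1)
    (r : nat -> R) (m : nat -> nat) (x : nat -> nat -> 'rV[R]_n.+1) :=
  [/\ forall j, 0 < r j,
      A `<=` \bigcup_(j in [set j | P j]) eball (y j) (r j) &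
      forall j, P j -> A `<=` \bigcup_(k in `I_(m j)) eball (x j k) (r j)].

Definition two_scale_sum (P : pred nat) (r : nat -> R) (m : nat -> nat) :=
  (\sum_(0 <= j <oo) ((P j)%:R * ((m j)%:R * r j ^+ n.+2))%:E)%E.

Context d (T : measurableType d) (mu : {measure set T -> \bar R}).
Variable c : T -> 'rV[R]_n.
Hypothesis mu_box : forall (a : 'rV[R]_n) (l : R), 0 <= l ->
  measurable [set p | forall i, `|c p 0 i - a 0 i| <= l] /\
  mu [set p | forall i, `|c p 0 i - a 0 i| <= l] = ((2 * l) ^+ n)%:E.

(** The set H need not be measurable; it lies in the cube of half side l around
    any of its points. *)
Lemma spread_cover (H : set T) (l : R) : 0 <= l ->
  (forall p q, H p -> H q -> forall i, `|c p 0 i - c q 0 i| <= l) ->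
  exists D, [/\ measurable D, H `<=` D & (mu D <= ((2 * l) ^+ n)%:E)%E].
Proof.
move=> l0 Hl; have [[q Hq]|H0] := pselect (exists q, H q).
  have [mB muB] := mu_box (c q) l0.
  by eexists; split; [exact: mB|move=> p Hp; exact: Hl|rewrite muB].
exists set0; split => //; first by move=> p Hp; case: H0; exists p.
by rewrite measure0 lee_fin exprn_ge0// mulr_ge0.
Qed.

Definition rich_slopes A (delta : R) : set T :=
  [set p | (forall i, `|c p 0 i| <= 1) /\ rich A delta (c p)].

(** The set H j k of slopes served by the pair (j, k) has diameter at most
    32 r_j / delta by [slope_separation], and is enclosed in a measurable D (j, k).
    The function sum_(j, k) r_j^2 1_(D (j, k)) is at least delta^2 / 8 at every
    rich slope, and its integral is at most the right-hand side. *)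
Lemma rich_slopes_cover A (delta : R) P y r m x : 0 < delta ->
  two_scale_cover A P y r m x ->
  exists M, [/\ measurable M, rich_slopes A delta `<=` M &
   ((delta ^+ 2 / 8)%:E * mu M <= ((64 / delta) ^+ n)%:E * two_scale_sum P r m)%E].
Proof.
move=> delta0 [r0 covy covx].
pose H j k : set T := [set p | rich_slopes A delta p /\
  exists t s u, [/\ delta / 4 <= `|s - u|,
    eball (x j k) (r j) (s *: slope_vector (c p) + t) &
    eball (y j) (r j) (u *: slope_vector (c p) + t)]].
have /choice[D HD] : forall jk : nat * nat, exists D, [/\ measurable D,
    H jk.1 jk.2 `<=` D & (mu D <= ((64 / delta * r jk.1) ^+ n)%:E)%E].
  move=> [j k] /=.
  have l0 : 0 <= 8 * r j / (delta / 4).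
    by rewrite !mulr_ge0// ?ltW// invr_gt0 divr_gt0.
  have [|D [mD HD muD]] := @spread_cover (H j k) _ l0.
    move=> p q [[p1 _] [t [s [u [su sx uy]]]]].
    move=> [[q1 _] [t' [s' [u' [su' sx' uy']]]]] i.
    by apply: slope_separation su sx uy sx' uy' _ => //; rewrite divr_gt0.
  exists D; split=> //; apply: (le_trans muD); rewrite lee_fin.
  rewrite (_ : 2 * _ = 64 / delta * r j)//.
  by field; rewrite gt_eqF.
(* [h] groups the pairs by j: within one j all radii agree. *)
pose h j p : R := (P j)%:R * \sum_(k < m j) r j ^+ 2 * \1_(D (j, val k)) p.
have h0 j p : 0 <= h j p.
  rewrite mulr_ge0// sumr_ge0// => k _; rewrite mulr_ge0 ?sqr_ge0//.
have mh j : measurable_fun setT (h j).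
  apply: measurable_funM => //; apply: measurable_sum => k.
  by apply: measurable_funM => //; apply: measurable_indic; have [] := HD (j, val k).
have [||||M [mM TM muM]] := @markov_series _ T R mu (fun j p => (h j p)%:E)
    (rich_slopes A delta) (delta ^+ 2 / 8) _ _ _ _.
- by move=> j p; rewrite lee_fin.
- by move=> j; exact/measurable_EFinP.
- by rewrite divr_gt0// exprn_gt0.
- move=> p Tp; have [p1 [t tA]] := Tp.
  (* Each touching ball contributes r_j to the sum of radii and, by [far_hits], at
     least r_j * (delta / 4) to [h]; hence the factor delta / 8 against 2 r_j. *)
  have touch := touching_radii r0 tA covy.
  have : ((delta / 8)%:E * delta%:E <= (delta / 8)%:E * \sum_(0 <= j <oo)
    (2 * r j * (P j && `[< exists u, eball (y j) (r j)
        (u *: slope_vector (c p) + t) >])%:R)%:E)%E.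
    by apply: lee_wpmul2l; rewrite // lee_fin divr_ge0// ltW.
  rewrite -EFinM (_ : _ * delta = delta ^+ 2 / 8); last by field.
  move/le_trans; apply; rewrite -nneseriesZl; last first.
    by move=> j _; rewrite lee_fin mulr_ge0// mulr_ge0// ltW.
  apply: lee_nneseries => [j _ _|j _].
    by rewrite lee_fin mulr_ge0// ?divr_ge0// ?mulr_ge0// ltW.
  rewrite -EFinM lee_fin /h; case Pj: (P j); last by rewrite /= mulr0 mulr0 mul0r.
  case: asboolP => [[u uy]|_] /=; last by rewrite !mulr0; have := h0 j p; rewrite /h Pj.
  rewrite mulr1 mul1r.
  have hits := far_hits u (r0 j) tA (covx j Pj).
  apply: (@le_trans _ _ (r j * (delta / 4))); first by lra.
  apply: (le_trans (ler_wpM2l (ltW (r0 j)) hits)).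
  rewrite mulr_sumr; apply: ler_sum => k _; rewrite mulrA -expr2.
  rewrite ler_wpM2l ?sqr_ge0// indicE ler_nat.
  case: asboolP => // -[s su sx] /=; rewrite lt0b inE.
  have [_ + _] := HD (j, val k); apply; split=> //.
  by exists t, s, u.
exists M; split=> //; apply: (le_trans muM).
rewrite /two_scale_sum -nneseriesZl; last first.
  by move=> j _; rewrite lee_fin mulr_ge0// mulr_ge0// exprn_ge0// ltW.
apply: lee_nneseries => [j _ _|j _]; first by apply: integral_ge0 => p _; rewrite lee_fin.
rewrite /h -EFinM.
under eq_integral do rewrite EFinM -sumEFin.
rewrite ge0_integralZl//=; last first.
- by move=> p _; apply: sume_ge0 => k _; rewrite lee_fin mulr_ge0// sqr_ge0.
- apply: emeasurable_sum => k; apply/measurable_EFinP.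
  by apply: measurable_funM => //; apply: measurable_indic; have [] := HD (j, val k).
rewrite (_ : (64 / delta) ^+ n * _ = (P j)%:R * (\sum_(k < m j)
    r j ^+ 2 * (64 / delta * r j) ^+ n)); last first.
  rewrite sumr_const card_ord -[X in _ = _ * X]mulr_natl [(_ * r j) ^+ n]exprMn -[n.+2]addn2 exprD.
  by move: (_ ^+ n) (r j ^+ n) => a b; ring.
rewrite EFinM; apply: lee_wpmul2l; first by rewrite lee_fin.
rewrite ge0_integral_sum//; last 2 first.
- move=> k; apply/measurable_EFinP.
  by apply: measurable_funM => //; apply: measurable_indic; have [] := HD (j, val k).
- by move=> k p _; rewrite lee_fin mulr_ge0// sqr_ge0.
rewrite -sumEFin; apply: lee_sum => k _.
have [mD _ muD] := HD (j, val k).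
under eq_integral do rewrite EFinM.
rewrite ge0_integralZl//=; last first.
- by rewrite lee_fin sqr_ge0.
- by apply/measurable_EFinP; exact: measurable_indic.
rewrite integral_indic// setIT [leRHS]EFinM; apply: lee_wpmul2l => //.
by rewrite lee_fin sqr_ge0.
Qed.

(** If the sums were not bounded below, [rich_slopes_cover] would enclose the rich
    slopes in measurable sets of arbitrarily small measure. *)
Lemma two_scale_sum_lower_bound A (delta : R) : 0 < delta ->
  ~ mu.-negligible (rich_slopes A delta) ->
  exists2 e : R, 0 < e & forall P y r m x,
    two_scale_cover A P y r m x -> (e%:E <= two_scale_sum P r m)%E.
Proof.
move=> delta0; apply: contra_notP => none.
pose C : R := (64 / delta) ^+ n.
have C0 : 0 < C by rewrite exprn_gt0// divr_gt0.
have /choice[M HM] : forall N : nat, exists M, [/\ measurable M,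
    rich_slopes A delta `<=` M & (mu M <= N.+1%:R^-1%:E)%E].
  move=> N; apply: contrapT => noM; apply: none.
  have d8 : 0 < delta ^+ 2 / 8 by rewrite divr_gt0// exprn_gt0.
  exists (delta ^+ 2 / 8 * N.+1%:R^-1 / C); first by rewrite !mulr_gt0// ?invr_gt0.
  move=> P y r m x cov; rewrite leNgt; apply/negP => lt; apply: noM.
  have [M [mM TM muM]] := rich_slopes_cover delta0 cov.
  exists M; split=> //.
  rewrite -(@lee_pmul2l _ (delta ^+ 2 / 8)%:E)//.
  apply: (le_trans muM); rewrite -/C -EFinM.
  apply: (@le_trans _ _ (C%:E * (delta ^+ 2 / 8 * N.+1%:R^-1 / C)%:E)%E).
    by apply: lee_wpmul2l (ltW lt); rewrite lee_fin ltW.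
  rewrite -EFinM lee_fin (_ : C * _ = delta ^+ 2 / 8 * N.+1%:R^-1)//.
  by rewrite mulrC divfK ?gt_eqF.
exists (\bigcap_N M N); split.
- by apply: bigcapT_measurable => N; have [] := HM N.
- apply/eqP; rewrite eq_le measure_ge0 andbT; apply/lee_addgt0Pr => e e0.
  rewrite add0e.
  have [N _ /(_ N (leqnn N)) Ne] := near_infty_natSinv_lt (PosNum e0).
  have [mM _ muM] := HM N.
  apply: (@le_trans _ _ (mu (M N))); last first.
    by apply: (le_trans muM); rewrite lee_fin ltW.
  apply: le_measure; rewrite ?inE//; last exact: bigcap_inf.
  by apply: bigcapT_measurable => k; have [] := HM k.
- by move=> p Tp N _; have [_ sub _] := HM N; exact: sub.
Qed.

End TwoScale.

(** * A rich piece of a Besicovitch set *)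

Section Besicovitch.
Variables (R : realType) (n : nat).
Implicit Types (K : set 'rV[R]_n.+1) (F : nat -> set 'rV[R]_n.+1).

Lemma enormZ m (a : R) (x : 'rV[R]_m) : enorm (a *: x) = `|a| * enorm x.
Proof.
rewrite /enorm -sqrtr_sqr -sqrtrM ?sqr_ge0// mulr_sumr.
by congr Num.sqrt; apply: eq_bigr => i _; rewrite mxE exprMn.
Qed.

(** The unit segment in the direction of (1, v) occupies the parameters from 0
    to 1 / |(1, v)|. *)
Lemma besicovitch_chord K (v : 'rV[R]_n) : besicovitch K ->
  exists t, (0 < outer_length (chord K v t))%E.
Proof.
move=> [_ hK]; pose w := slope_vector v.
have w1 : 1 <= enorm w.
  by have := ler_enorm w ord0; rewrite slope_vector0 normr1.
have w0 : 0 < enorm w by exact: lt_le_trans w1.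
have [|t ht] := hK ((enorm w)^-1 *: w).
  by rewrite /esphere /= enormZ ger0_norm ?invr_ge0 ?ltW// mulVf ?gt_eqF.
exists t; apply: (@lt_le_trans _ _ (outer_length `[0, (enorm w)^-1])).
  by rewrite outer_length_itv ?invr_ge0 ?ltW// lte_fin subr0 invr_gt0.
apply: le_outer_length => s /=; rewrite in_itv /= => /andP[s0 s1].
apply: ht; exists (s * enorm w).
  rewrite /= in_itv /= mulr_ge0 ?(ltW w0)//=.
  by rewrite -(mulVf (lt0r_neq0 w0)) ler_wpM2r// ltW.
by rewrite scalerA mulfK ?gt_eqF.
Qed.

Lemma rich_piece K F (v : 'rV[R]_n) : besicovitch K -> K `<=` \bigcup_i F i ->
  exists i N : nat, rich (F i) N.+1%:R^-1 v.
Proof.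
move=> hK KF; have [t t0] := besicovitch_chord v hK.
have [i Fi] : exists i, (0 < outer_length (chord (F i) v t))%E.
  apply: contrapT => none; move: t0; rewrite ltNge => /negP; apply.
  apply: (@le_trans _ _ (outer_length (\bigcup_i chord (F i) v t))).
    by apply: le_outer_length => s /KF[i _ Fis]; exists i.
  apply: (le_trans (outer_length_bigcup _)); rewrite eseries0// => i _ _.
  apply/eqP; rewrite eq_le outer_length_ge0 andbT leNgt; apply/negP => Fi.
  by apply: none; exists i.
suff [N Ni] : exists N : nat, (N.+1%:R^-1%:E <= outer_length (chord (F i) v t))%E.
  by exists i, N, t.
case: (outer_length _) Fi => [r| |] //; last by exists 0%N; rewrite leey.
rewrite lte_fin => r0.
have [N _ /(_ N (leqnn N)) Nr] := near_infty_natSinv_lt (PosNum r0).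
by exists N; rewrite lee_fin ltW.
Qed.

(** The sets of slopes that are rich for F i at level 1 / (N + 1) exhaust the cube
    of slopes as i and N vary, so they cannot all be negligible. *)
Lemma besicovitch_piece K F : besicovitch K -> K `<=` \bigcup_i F i ->
  exists i, exists2 e : R, 0 < e & forall P y r m x,
    two_scale_cover (F i) P y r m x -> (e%:E <= two_scale_sum n P r m)%E.
Proof.
move=> hK KF; have [disp [T [mu [c mu_box]]]] := slope_space R n.
apply: contrapT => none.
have null i N : mu.-negligible (rich_slopes c (F i) N.+1%:R^-1).
  apply: contrapT => nn; apply: none; exists i.
  have N0 : (0 : R) < N.+1%:R^-1 by rewrite invr_gt0.
  exact: (two_scale_sum_lower_bound mu_box N0 nn).
have : mu.-negligible (\bigcup_i \bigcup_N rich_slopes c (F i) N.+1%:R^-1).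
  by apply: negligible_bigcup => i; exact: negligible_bigcup.
have [mQ muQ] := mu_box 0 1 ler01.
set Q := [set p | _] in mQ muQ.
have QU : Q `<=` \bigcup_i \bigcup_N rich_slopes c (F i) N.+1%:R^-1.
  move=> p Qp; have [i [N iN]] := rich_piece (c p) hK KF.
  exists i => //; exists N => //; split=> // k.
  by have := Qp k; rewrite mxE subr0.
move=> /(negligibleS QU) /(measure_negligible mQ) muQ0.
have /eqP := etrans (esym muQ) muQ0.
by rewrite eqe mulr1 expf_eq0 pnatr_eq0 andbF.
Qed.

End Besicovitch.

(** * Box dimensions *)

Section BoxDimension.
Variables (R : realType) (n : nat).
Implicit Types (A K : set 'rV[R]_n.+1).

(** The same m balls of radius rho serve at both scales: the sum consists of m
    terms m rho^(n+2). *)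
Lemma two_scale_covering_number A (e : R) :
  (forall P y r m x, two_scale_cover A P y r m x ->
    (e%:E <= two_scale_sum n P r m)%E) ->
  forall (rho : R) (m : nat) (c : 'I_m -> 'rV[R]_n.+1), 0 < rho ->
    A `<=` \bigcup_i eball (c i) rho -> e <= m%:R ^+ 2 * rho ^+ n.+2.
Proof.
move=> hA rho m c rho0 cov.
pose y j : 'rV[R]_n.+1 := oapp c 0 (insub j).
have covy : A `<=` \bigcup_(k in `I_m) eball (y k) rho.
  move=> a /cov[i _ ai]; exists (val i); first exact: ltn_ord.
  by rewrite /y valK.
have /hA : two_scale_cover A (fun j => (j < m)%N) y (fun=> rho) (fun=> m) (fun=> y).
  by split.
rewrite -lee_fin => /le_trans; apply.
rewrite /two_scale_sum (nneseries_split 0 m); last first.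
  by move=> k _; rewrite lee_fin mulr_ge0// mulr_ge0// exprn_ge0// ltW.
rewrite add0n [X in (_ + X)%E]eseries0 ?adde0; last first.
  by move=> k mk _; rewrite ltnNge mk mul0r.
rewrite big_mkord (eq_bigr (fun=> (m%:R * rho ^+ n.+2)%:E)); last first.
  by move=> k _; rewrite ltn_ord mul1r.
by rewrite sumEFin sumr_const card_ord lee_fin -[leLHS]mulr_natl mulrA -expr2.
Qed.

Lemma lower_box_dim_ge A (e : R) : 0 < e ->
  (forall (rho : R) (m : nat) (c : 'I_m -> 'rV[R]_n.+1), 0 < rho ->
    A `<=` \bigcup_i eball (c i) rho -> e <= m%:R ^+ 2 * rho ^+ n.+2) ->
  (((n.+1%:R + 1) / 2 : R)%:E <= lower_box_dim A)%E.
Proof.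
move=> e0 hA; rewrite /lower_box_dim limf_einfE.
apply/lee_subgt0Pr => delta delta0.
(* Below expR (- L) the constant e costs at most delta in the ratio, and
   - ln rho is positive. *)
pose L := `|ln e| / (2 * delta) + 1.
have L0 : 0 < L by rewrite ltr_wpDl// divr_ge0// mulr_ge0// ltW.
apply: ereal_sup_ge.
exists (ereal_inf (box_ratio A @` [set rho | 0 < rho < expR (- L)])).
  exists [set rho | 0 < rho < expR (- L)] => //.
  near=> rho; apply/andP; split; near: rho.
    exact: nbhs_right_gt.
  by apply: nbhs_right_lt; exact: expR_gt0.
apply: le_ereal_inf_tmp => _ [rho /andP[rho0 rhoL] <-].
have lnL : L <= - ln rho.
  by rewrite lerNr -[X in _ <= X]expRK ler_ln ?posrE ?expR_gt0// ltW.
have lnrho : 0 < - ln rho by exact: lt_le_trans lnL.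
rewrite /box_ratio inver gt_eqF// lee_pdivlMr// -EFinB -EFinM.
(* expR z is the lower bound sqrt (e / rho ^+ n.+2) for the number of balls. *)
pose z := (ln e - n.+2%:R * ln rho) / 2.
apply: (@le_trans _ _ z%:E).
  rewrite lee_fin /z.
  have : `|ln e| <= (- ln rho) * (2 * delta).
    rewrite -ler_pdivrMr ?mulr_gt0//; apply: le_trans lnL.
    by rewrite /L lerDl.
  rewrite ler_norml => /andP[le1 le2].
  by rewrite -[n.+2%:R]natr1; nra.
have : ((expR z)%:E <= covering_number A rho)%E.
  apply: le_ereal_inf_tmp => _ [m [c cov] <-].
  rewrite lee_fin -(@ler_pXn2r _ 2) ?nnegrE ?expR_ge0//.
  have := hA rho m c rho0 cov.
  rewrite -ler_pdivrMr ?exprn_gt0//; apply: le_trans.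
  rewrite -expRM_natl /z mulrC divfK// expRB lnK ?posrE//.
  by rewrite expRM_natl lnK ?posrE.
case: (covering_number A rho) => [a| |] //=; rewrite ?leey//.
rewrite lee_fin => za; have a0 : 0 < a by exact: lt_le_trans (expR_gt0 _) za.
by rewrite (lt_geF a0) lee_fin -ler_expR lnK ?posrE.
Unshelve. all: by end_near. Qed.

Lemma lower_upper_box_dim A : (lower_box_dim A <= upper_box_dim A)%E.
Proof.
rewrite /lower_box_dim /upper_box_dim limf_einfE limf_esupE.
apply: ge_ereal_sup => _ [V FV <-]; apply: le_ereal_inf_tmp => _ [W FW <-].
have [rho [Vrho Wrho]] := filter_ex (filterI FV FW).
apply: (@le_trans _ _ (box_ratio A rho)).
  by apply: ereal_inf_lbound; exists rho.
by apply: ereal_sup_ubound; exists rho.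
Qed.

Lemma upper_box_dim_cover A (alpha : R) : (upper_box_dim A < alpha%:E)%E ->
  exists2 e : R, 0 < e & forall rho, 0 < rho < e ->
  exists m : nat, (m%:R <= rho `^ (- alpha)) /\
    exists c : 'I_m -> 'rV[R]_n.+1, A `<=` \bigcup_i eball (c i) rho.
Proof.
rewrite /upper_box_dim limf_esupE => /ereal_inf_lt[_ [V FV <-] supV].
have [e /= e0 He] : \forall rho \near 0^'+, V rho by [].
exists (Num.min e 1); first by rewrite lt_min e0 ltr01.
move=> rho /andP[rho0]; rewrite lt_min => /andP[rhoe rho1].
have Vrho : V rho.
  by apply: He => //=; rewrite sub0r normrN gtr0_norm.
have lnrho : 0 < - ln rho by rewrite oppr_gt0 ln_lt0// rho0 rho1.
have : (box_ratio A rho < alpha%:E)%E.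
  by apply: le_lt_trans supV; apply: ereal_sup_ubound; exists rho.
rewrite /box_ratio inver gt_eqF// lte_pdivrMr// -EFinM => lt.
have : (covering_number A rho < (rho `^ (- alpha))%:E)%E.
  rewrite /powR gt_eqF//; move: lt.
  case: (covering_number A rho) => [a| |] //=; last by move=> _; exact: ltNyr.
  case: (leP a 0) => [a0 _|a0]; rewrite !lte_fin.
    by apply: le_lt_trans a0 _; exact: expR_gt0.
  by rewrite mulrN -mulNr -{2}(lnK a0) ltr_expR.
move/ereal_inf_lt => [_ [m [c cov] <-]]; rewrite lte_fin => mlt.
by exists m; split; [exact: ltW|exists c].
Qed.

End BoxDimension.

(** * Hausdorff covers *)

Section Hausdorff.
Variables (R : realType) (n : nat).
Implicit Types (A K U : set 'rV[R]_n.+1).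

Lemma hausdorff_null_cover K (s c e : R) :
  hausdorff_measure s K = 0%E -> 0 < c -> 0 < e ->
  exists F : nat -> set 'rV[R]_n.+1, [/\ K `<=` \bigcup_i F i,
    forall i, (diam (F i) <= e%:E)%E &
    (\sum_(0 <= i <oo) diam_pow s (F i) < c%:E)%E].
Proof.
move=> H0 c0 e0.
have : (hausdorff_premeasure s e K < c%:E)%E.
  apply: (@le_lt_trans _ _ 0%E); last by rewrite lte_fin.
  by rewrite -H0; apply: ereal_sup_ubound; exists e.
by move=> /ereal_inf_lt[_ [F [KF Fe] <-] Fc]; exists F.
Qed.

Lemma diam_eball U (e : R) y : U y -> (diam U <= e%:E)%E ->
  exists D : R, [/\ 0 <= D, D <= e, diam U = D%:E & U `<=` eball y D].
Proof.
move=> Uy Ue.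
have ub x : U x -> ((enorm (x - y))%:E <= diam U)%E.
  by move=> Ux; apply: ereal_sup_ubound; exists x => //; exists y.
have := ub y Uy; move: ub Ue; case: (diam U) => [D| |] //=.
move=> ub De; rewrite lee_fin => D0; exists D; split=> //.
by apply: le_trans D0; exact: sqrtr_ge0.
Qed.

(** Put s' = n + 2 - alpha > s.  A member of diameter D of the Hausdorff cover is
    placed in a ball of radius r = max(D, tau), where tau > 0 takes care of
    one-point members and is small enough for the extra terms tau^s' to have a
    small sum.  Then m r^(n+2) <= r^s' <= D^s + tau^s', because D <= 1. *)
Lemma upper_box_hausdorff A K (e alpha s : R) : A `<=` K -> 0 < e ->
  (forall P y r m x, two_scale_cover A P y r m x ->
    (e%:E <= two_scale_sum n P r m)%E) ->
  (upper_box_dim A < alpha%:E)%E -> 0 <= s -> hausdorff_measure s K = 0%E ->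
  n.+2%:R <= alpha + s.
Proof.
move=> AK e0 hA /upper_box_dim_cover[e1 e10 hbox] s0 Hs.
rewrite leNgt; apply/negP => lt.
pose s' := n.+2%:R - alpha.
have ss' : s < s' by rewrite /s'; lra.
have s'0 : 0 < s' by exact: le_lt_trans ss'.
pose e2 := Num.min e1 1 / 2.
have e20 : 0 < e2 by rewrite divr_gt0// lt_min e10 ltr01.
have [e2e1 e21] : e2 < e1 /\ e2 < 1.
  have m1 : Num.min e1 1 <= e1 by rewrite ge_min lexx.
  have m2 : Num.min e1 1 <= 1 by rewrite ge_min lexx orbT.
  by rewrite /e2; split; lra.
have e4 : 0 < e / 4 by rewrite divr_gt0.
have [F [KF Fe2 sumF]] := hausdorff_null_cover Hs e4 e20.
pose c j : R := e / 4 / (2 ^ j.+1)%:R.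
have c0 j : 0 < c j by rewrite divr_gt0// ltr0n expn_gt0.
pose P : pred nat := fun j => F j != set0.
have /choice[w Hw] : forall j, exists w : 'rV[R]_n.+1 * R * nat * (nat -> 'rV[R]_n.+1),
    let: (y, r, m, x) := w in [/\ 0 < r, F j `<=` eball y r,
      A `<=` \bigcup_(k in `I_m) eball (x k) r &
      (((P j)%:R * (m%:R * r ^+ n.+2))%:E <= diam_pow s (F j) + (c j)%:E)%E].
  move=> j.
  have tau0 : 0 < c j `^ (s'^-1) by rewrite powR_gt0.
  pose tau := Num.min e2 (c j `^ (s'^-1)).
  have tau1 : 0 < tau by rewrite lt_min e20.
  have taue2 : tau <= e2 by rewrite ge_min lexx.
  have tauc : tau `^ s' <= c j.
    apply: (@le_trans _ _ ((c j `^ (s'^-1)) `^ s')).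
      by apply: ge0_ler_powR; rewrite ?nnegrE ?(ltW s'0) ?(ltW tau1) ?(ltW tau0)// ge_min lexx orbT.
    by rewrite -powRrM mulVf ?gt_eqF// powRr1// ltW.
  have box r : 0 < r -> r <= e2 -> exists m : nat, exists x : nat -> 'rV[R]_n.+1,
      A `<=` \bigcup_(k in `I_m) eball (x k) r /\ m%:R * r ^+ n.+2 <= r `^ s'.
    move=> r0 re2; have [|m [mr [x covx]]] := hbox r.
      by rewrite r0 (le_lt_trans re2).
    exists m, (fun k => oapp x 0 (insub k)); split.
      by move=> a /covx[i _ ai]; exists (val i); [exact: ltn_ord|rewrite valK].
    rewrite -powR_mulrn ?(ltW r0)//.
    apply: (le_trans (ler_wpM2r (powR_ge0 r n.+2%:R) mr)).
    by rewrite -powRD ?gt_eqF// ?implybT// addrC.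
  have [/eqP Fj0|/set0P[y Fy]] := boolP (F j == set0).
    have [m [x [covx _]]] := box tau tau1 taue2.
    exists (0, tau, m, x); split=> //; first by rewrite Fj0.
    rewrite /P Fj0 eqxx mul0r; apply: adde_ge0; last by rewrite lee_fin ltW.
    by rewrite /diam_pow eqxx.
  have [D [D0 De2 diamD FD]] := diam_eball Fy (Fe2 j).
  pose r := Num.max D tau.
  have r0 : 0 < r by rewrite lt_max tau1 orbT.
  have re2 : r <= e2 by rewrite ge_max De2.
  have [m [x [covx mr]]] := box r r0 re2.
  exists (y, r, m, x); split=> //.
    by move=> z /FD zD; apply: le_trans zD _; rewrite le_max lexx.
  have Fj0 : F j != set0 by apply/set0P; exists y.
  rewrite /P Fj0 mul1r /diam_pow (negbTE Fj0) diamD poweR_EFin -EFinD lee_fin.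
  apply: (le_trans mr).
  apply: (@le_trans _ _ (D `^ s' + tau `^ s')).
    rewrite /r; case: (leP D tau) => _; first by rewrite lerDr powR_ge0.
    by rewrite lerDl powR_ge0.
  apply: lerD => //.
  have [->|Dn0] := eqVneq D 0; first by rewrite powR0 ?gt_eqF// powR_ge0.
  have Dp : 0 < D by rewrite lt_neqAle eq_sym Dn0.
  by apply: ger_powR; [rewrite Dp (le_trans De2) ?ltW|exact: ltW].
pose y j := (w j).1.1.1; pose r j := (w j).1.1.2; pose m j := (w j).1.2.
pose x j := (w j).2.
have Hwj j : [/\ 0 < r j, F j `<=` eball (y j) (r j),
    A `<=` \bigcup_(k in `I_(m j)) eball (x j k) (r j) &
    (((P j)%:R * ((m j)%:R * r j ^+ n.+2))%:E <= diam_pow s (F j) + (c j)%:E)%E].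
  by have := Hw j; rewrite /y /r /m /x; case: (w j) => [[[? ?] ?] ?].
have cov : two_scale_cover A P y r m x.
  split=> [j|a /AK/KF[j _ Fja]|j _]; [by have [] := Hwj j| |by have [] := Hwj j].
  exists j; first by apply/set0P; exists a.
  by have [_ sub _ _] := Hwj j; exact: sub.
have diam_pow_ge0 j : (0 <= diam_pow s (F j))%E.
  by rewrite /diam_pow; case: ifP => // _; exact: poweR_ge0.
have := hA _ _ _ _ _ cov; rewrite leNgt => /negP; apply.
apply: (@le_lt_trans _ _ (\sum_(0 <= j <oo) (diam_pow s (F j) + (c j)%:E))%E).
  apply: lee_nneseries => [j _ _|j _]; last by have [] := Hwj j.
  have [rj _ _ _] := Hwj j.
  by rewrite lee_fin mulr_ge0// mulr_ge0// exprn_ge0// ltW.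
apply: (le_lt_trans (epsilon_trick xpredT diam_pow_ge0 (ltW e4))).
apply: (@lt_trans _ _ ((e / 4)%:E + (e / 4)%:E)%E); first by rewrite lteD2rE.
by rewrite -EFinD lte_fin; lra.
Qed.

Lemma hausdorff_dim_ge0 K : (0 <= hausdorff_dim K)%E.
Proof. by apply: le_ereal_inf_tmp => _ [s [s0 _] <-]; rewrite lee_fin. Qed.

End Hausdorff.

Theorem theorem4p3 (R : realType) (d : nat) (hd : (0 < d)%N)
    (K : set 'rV[R]_d) (hK : besicovitch K) :
  [/\ (((d%:R + 1) / 2 : R)%:E <= lower_box_dim K)%E,
      (((d%:R + 1) / 2 : R)%:E <= packing_dim K)%E &
      ((d%:R + 1 : R)%:E <= packing_dim K + hausdorff_dim K)%E].
Proof.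
case: d hd K hK => // n _ K hK.
have half : (((n.+1%:R + 1) / 2 : R)%:E <= packing_dim K)%E.
  apply: le_ereal_inf_tmp => _ [F KF <-].
  have KsubF : K `<=` \bigcup_i F i by rewrite -KF.
  have [i [e e0 hF]] := besicovitch_piece hK KsubF.
  have low := lower_box_dim_ge e0 (two_scale_covering_number hF).
  apply: (le_trans low); apply: (le_trans (lower_upper_box_dim _)).
  by apply: ereal_sup_ubound; exists i.
split=> //.
  have KK : K `<=` \bigcup_(i : nat) K by move=> a Ka; exists 0%N.
  have [_ [e e0 hF]] := besicovitch_piece hK KK.
  exact: lower_box_dim_ge e0 (two_scale_covering_number hF).
move: half; case Pk: (packing_dim K) => [p| |] // _; last first.
  by rewrite addye ?leey// gt_eqF// (lt_le_trans _ (hausdorff_dim_ge0 K)).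
have := hausdorff_dim_ge0 K.
case Hk: (hausdorff_dim K) => [h| |] // _; last by rewrite addey ?leey.
rewrite -EFinD lee_fin leNgt; apply/negP => lt.
(* The missing amount is shared equally between alpha and s. *)
pose g := (n.+1%:R + 1 - (p + h)) / 2.
have g0 : 0 < g by rewrite /g; lra.
have : (packing_dim K < (p + g)%:E)%E by rewrite Pk lte_fin ltrDl.
move=> /ereal_inf_lt[_ [F KF <-] supF].
have : (hausdorff_dim K < (h + g)%:E)%E by rewrite Hk lte_fin ltrDl.
move=> /ereal_inf_lt[_ [s [s0 Hs] <-]]; rewrite lte_fin => sh.
have KsubF : K `<=` \bigcup_i F i by rewrite -KF.
have [i [e e0 hF]] := besicovitch_piece hK KsubF.
have FK : F i `<=` K by rewrite KF => a Fa; exists i.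
have boxF : (upper_box_dim (F i) < (p + g)%:E)%E.
  by apply: le_lt_trans supF; apply: ereal_sup_ubound; exists i.
have := upper_box_hausdorff FK e0 hF boxF s0 Hs.
by rewrite -natr1; rewrite /g in sh *; lra.
Qed.
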